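(* Let $x:X\to\mathbb{N}$ be a graded set. Then the graded set $taut(X):=[X,X]$ admits the structure of a nonsymmetric operad, i.e. the structure of a monoid in $\mathbf{GrdSet}$ with respect to the monoidal product $\square$.
   Context: Let $(T,\mu,\eta)$ be the free monoid monad on $\mathbf{Set}$ and identify $T(\{*\})$ with $\mathbb{N}$ ($0\in\mathbb{N}$). A graded set is a set $X$ with a function $x:X\to\mathbb{N}$ (arity map). Morphisms of graded sets are functions over $\mathbb{N}$, so $\mathbf{GrdSet}=\mathbf{Set}/\mathbb{N}$. For graded sets $x:X\to\mathbb{N}$, $y:Y\to\mathbb{N}$, the composition tensor product $X\,\square\,Y$ is the pullback of $x:X\to T(\{*\})$ and $T(!_Y):T(Y)\to T(\{*\})$ (with $!_Y:Y\to\{*\}$), with arity map the composite $X\,\square\,Y\to T(Y)\xrightarrow{T(y)}T^2(\{*\})\xrightarrow{\mu_{\{*\}}}T(\{*\})$. Its elements are pairs $(a,\psi)$ with $a\in X$ and $\psi$ a word in $Y$ of length $x(a)$, with arity the sum of the arities of the letters of $\psi$. On morphisms $(f\,\square\,g)(a,\psi)=(f(a),T(g)(\psi))$. $(\mathbf{GrdSet},\square,\{*\})$ is a monoidal category with unit $i:\{*\}\hookrightarrow\mathbb{N}$ (the one-point set in arity $1$), associator $X\,\square\,(Y\,\square\,Z)\to(X\,\square\,Y)\,\square\,Z$, $(a,(b_1,w_1)\cdots(b_k,w_k))\mapsto((a,b_1\cdots b_k),w_1\cdots w_k)$, left unitor $( *,a)\mapsto a$, and right unitor the first projection. A nonsymmetric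 operad is a monoid object in this monoidal category. For a graded set $b:B\to\mathbb{N}$, the internal hom functor $[B,-]:\mathbf{GrdSet}\to\mathbf{GrdSet}$ is the right adjoint of $-\,\square\,B$. It is given by $[B,-]=\Pi_{T(!_B)}\,T(b)^*\,\mu_{\{*\}}^*$, where for a function $f$, $f^*$ denotes pullback along $f$ between slice categories of $\mathbf{Set}$ and $\Pi_f$ is the right adjoint of $f^*$. Concretely, for $a:A\to\mathbb{N}$, the elements of $[B,A]$ of arity $n$ form the set $[B,A]_n\cong\prod_{\beta=\beta_1\cdots\beta_n\in B^n}\{p\in A: a(p)=\sum_{i=1}^nb(\beta_i)\}$. *)

(* Defs.v *)
From mathcomp Require Import all_boot.
From Stdlib Require Import FunctionalExtensionality ProofIrrelevance.

Set Implicit Arguments.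
Unset Strict Implicit.
Unset Printing Implicit Defensive.

(* Slice categories Set/I.  "Sets" are types with Leibniz equality.           *)

Record slice (I : Type) : Type := Slice {
  carrier :> Type;
  over : carrier -> I
}.
Arguments over {I} s _.

Record hom (I : Type) (X Y : slice I) : Type := Hom {
  hom_fun :> X -> Y;
  hom_over : forall a : X, over Y (hom_fun a) = over X a
}.

Definition idhom {I : Type} (X : slice I) : hom X X :=
  @Hom I X X (fun a => a) (fun a => erefl).

Lemma comp_over (I : Type) (X Y Z : slice I) (g : hom Y Z) (f : hom X Y) a :
  over Z (g (f a)) = over X a.
Proof. by rewrite !hom_over. Qed.

Definition comp {I : Type} {X Y Z : slice I} (g : hom Y Z) (f : hom X Y) :
  hom X Z := Hom (comp_over g f).

(* Leibniz equality of morphisms is equality of the underlying functions.     *)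
Lemma hom_ext (I : Type) (X Y : slice I) (f g : hom X Y) : f =1 g -> f = g.
Proof.
case: f g => [f Hf] [g Hg] /= fg.
have E : f = g by apply: functional_extensionality.
by subst g; rewrite (proof_irrelevance _ Hf Hg).
Qed.

Definition fprod_over {A B I : Type} (f : A -> I) (g : B -> I) : Type :=
  {p : A * B | f p.1 = g p.2}.

Lemma fprod_over_inj (A B I : Type) (f : A -> I) (g : B -> I)
  (p q : fprod_over f g) : sval p = sval q -> p = q.
Proof.
case: p q => [p Hp] [q Hq] /= E; subst q.
by rewrite (proof_irrelevance _ Hp Hq).
Qed.

Definition pull {J I : Type} (f : J -> I) (E : slice I) : slice J :=
  @Slice J (fprod_over f (over E)) (fun p => (sval p).1).

(* The fibre of Pi_f E over i is the set of sections of E over the fibre of f *)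
(* at i.                                                                      *)
Definition Pi {J I : Type} (f : J -> I) (E : slice J) : slice I :=
  @Slice I
    {i : I & forall j : {j : J | f j = i}, {e : E | over E e = sval j}}
    (fun p => projT1 p).

(* Graded sets.  The free monoid monad is seq, with multiplication flatten;   *)
(* the identification T({ * }) = nat is size, under which T(!) : T(Y) -> nat  *)
(* is size and mu : T(T({ * })) = seq nat -> nat is sumn (cf. size_flatten).  *)

Definition grdset : Type := slice nat.

Definition tensor (X Y : grdset) : grdset :=
  @Slice nat (fprod_over (over X) (@size Y))
    (fun p => sumn (map (over Y) (sval p).2)).

Lemma tensor_hom_wd (X X' Y Y' : grdset) (f : hom X X') (g : hom Y Y')
  (p : tensor X Y) : over X' (f (sval p).1) = size (map g (sval p).2).
Proof. by rewrite hom_over size_map (svalP p). Qed.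

Definition tensor_fun {X X' Y Y' : grdset} (f : hom X X') (g : hom Y Y')
  (p : tensor X Y) : tensor X' Y' :=
  exist _ (f (sval p).1, map g (sval p).2) (tensor_hom_wd f g p).

Lemma tensor_fun_over (X X' Y Y' : grdset) (f : hom X X') (g : hom Y Y')
  (p : tensor X Y) :
  over (tensor X' Y') (tensor_fun f g p) = over (tensor X Y) p.
Proof.
by rewrite /= -map_comp; congr sumn; apply: eq_map => b /=; rewrite hom_over.
Qed.

Definition tensor_hom {X X' Y Y' : grdset} (f : hom X X') (g : hom Y Y') :
  hom (tensor X Y) (tensor X' Y') := Hom (tensor_fun_over f g).

Definition grdunit : grdset := @Slice nat unit (fun _ => 1).

Lemma assoc_wd1 (X Y Z : grdset) (p : tensor X (tensor Y Z)) :
  over X (sval p).1 = size [seq (sval q).1 | q <- (sval p).2].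
Proof. by rewrite size_map (svalP p). Qed.

Definition assoc_left {X Y Z : grdset} (p : tensor X (tensor Y Z)) : tensor X Y :=
  exist _ ((sval p).1, [seq (sval q).1 | q <- (sval p).2]) (assoc_wd1 p).

Lemma assoc_wd2 (X Y Z : grdset) (p : tensor X (tensor Y Z)) :
  over (tensor X Y) (assoc_left p)
  = size (flatten [seq (sval q).2 | q <- (sval p).2]).
Proof.
rewrite /= size_flatten /shape -!map_comp; congr sumn.
by apply: eq_map => q /=; rewrite (svalP q).
Qed.

Definition assoc_fun {X Y Z : grdset} (p : tensor X (tensor Y Z)) : tensor (tensor X Y) Z :=
  exist _ (assoc_left p, flatten [seq (sval q).2 | q <- (sval p).2])
    (assoc_wd2 p).

Lemma assoc_over (X Y Z : grdset) (p : tensor X (tensor Y Z)) :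
  over (tensor (tensor X Y) Z) (assoc_fun p) = over (tensor X (tensor Y Z)) p.
Proof. by rewrite /= map_flatten sumn_flatten -!map_comp. Qed.

Definition assoc {X Y Z : grdset} :
  hom (tensor X (tensor Y Z)) (tensor (tensor X Y) Z) :=
  Hom (@assoc_over X Y Z).

Definition the_letter {A : Type} (w : seq A) : 1 = size w -> A :=
  match w return 1 = size w -> A with
  | [:: a] => fun=> a
  | [::] => fun e => match O_S 0 (esym e) with end
  | _ :: _ :: _ => fun e => match O_S _ (succn_inj e) with end
  end.

Lemma the_letterK (A : Type) (w : seq A) (e : 1 = size w) :
  [:: the_letter e] = w.
Proof. by case: w e => [|a [|b w]]. Qed.

Definition lunit_fun {X : grdset} (p : tensor grdunit X) : X := the_letter (svalP p).

Lemma lunit_over (X : grdset) (p : tensor grdunit X) :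
  over X (lunit_fun p) = over (tensor grdunit X) p.
Proof. rewrite /lunit_fun; move: (svalP p) => /= e.
by rewrite -[X in map _ X](the_letterK e) /= addn0. Qed.

Definition lunit {X : grdset} : hom (tensor grdunit X) X :=
  Hom (@lunit_over X).

Lemma runit_over (X : grdset) (p : tensor X grdunit) :
  over X (sval p).1 = over (tensor X grdunit) p.
Proof.
by rewrite (svalP p) /=; elim: (sval p).2 => //= _ w ->; rewrite add1n.
Qed.

Definition runit {X : grdset} : hom (tensor X grdunit) X :=
  @Hom nat (tensor X grdunit) X (fun p => (sval p).1) (@runit_over X).

(* The structure of a nonsymmetric operad on a graded set, i.e. of a monoid   *)
(* object in (GrdSet, tensor, grdunit).                                       *)
Record operad_structure (A : grdset) : Type := OperadStructure {
  op_mul : hom (tensor A A) A;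
  op_unit : hom grdunit A;
  op_mulA : comp (comp op_mul (tensor_hom op_mul (idhom A))) assoc
            = comp op_mul (tensor_hom (idhom A) op_mul);
  op_mul1l : comp op_mul (tensor_hom op_unit (idhom A)) = lunit;
  op_mul1r : comp op_mul (tensor_hom (idhom A) op_unit) = runit
}.

Definition ihom (B A : grdset) : grdset :=
  Pi (@size B) (pull (map (over B)) (pull sumn A)).

Definition taut (X : grdset) : grdset := ihom X X.

(* ihom B is right adjoint to tensor ^~ B, with counit ihom_ev.               *)

Definition ihom_app {B A : grdset} (p : tensor (ihom B A) B) : A :=
  (sval (sval (sval (projT2 (sval p).1
     (exist _ (sval p).2 (esym (svalP p)))))).2).2.

Lemma ihom_app_over (B A : grdset) (p : tensor (ihom B A) B) :
  over A (ihom_app p) = over (tensor (ihom B A) B) p.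
Proof.
case: p => [[[n phi] w] /= Hn]; rewrite /ihom_app /=.
case: (phi _) => -[[v [[l a] /= Hl]] /= Hv] /= Ev.
by rewrite -Hl -Hv Ev.
Qed.

Definition ihom_ev (B A : grdset) : hom (tensor (ihom B A) B) A :=
  Hom (@ihom_app_over B A).

Lemma ihom_ext (B A : grdset) (p q : ihom B A) :
  over (ihom B A) p = over (ihom B A) q ->
  (forall (w : seq B) (Hp : over (ihom B A) p = size w)
     (Hq : over (ihom B A) q = size w),
     ihom_app (exist _ (p, w) Hp) = ihom_app (exist _ (q, w) Hq)) ->
  p = q.
Proof.
case: p q => [n phi] [m psi] /= E; subst m => H; congr existT.
apply: functional_extensionality_dep => -[w Hw]; have := H w (esym Hw) (esym Hw).
rewrite /ihom_app /= !(proof_irrelevance _ (esym _) Hw).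
case: (phi _) => -[[v [[l a] /= Ha]] /= Hv] /= Ev.
case: (psi _) => -[[v' [[l' a'] /= Ha']] /= Hv'] /= Ev' Ea.
subst v v' a'; subst l l'.
by rewrite (proof_irrelevance _ Ha Ha').
Qed.

Definition ihom_curry_fun {C B A : grdset} (g : hom (tensor C B) A) (c : C) :
  ihom B A :=
  existT _ (over C c) (fun j : {w : seq B | size w = over C c} =>
    let p : tensor C B := exist _ (c, sval j) (esym (svalP j)) in
    let a : pull sumn A :=
      exist _ (map (over B) (sval j), g p) (esym (hom_over g p)) in
    let e : pull (map (over B)) (pull sumn A) :=
      exist _ (sval j, a) erefl in
    exist _ e erefl).

Definition ihom_curry {C B A : grdset} (g : hom (tensor C B) A) :
  hom C (ihom B A) :=
  @Hom nat C (ihom B A) (ihom_curry_fun g) (fun c => erefl).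

Lemma ihom_adjoint (C B A : grdset) (g : hom (tensor C B) A) :
  exists! h : hom C (ihom B A),
    comp (ihom_ev B A) (tensor_hom h (idhom B)) = g.
Proof.
exists (ihom_curry g); split.
  apply: hom_ext => -[[c w] Hw] /=; rewrite /ihom_app /=.
  by congr (g _); apply: fprod_over_inj; rewrite /= map_id.
move=> h E; subst g; apply: hom_ext => c.
apply: ihom_ext => [|w Hp Hq]; first by rewrite !hom_over.
rewrite [LHS]/ihom_app /=; congr ihom_app.
by apply: fprod_over_inj; rewrite /= map_id.
Qed.

(* Main.v *)
From mathcomp Require Import all_boot.
Require Import Defs.

(** Since [assoc] is invertible, the multiplication and the unit of [X,X] can
    be defined as the transposes of the iterated evaluation
      (T □ T) □ X -> T □ (T □ X) -> T □ X -> X,   where T = [X,X],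
    and of the left unitor.  The monoid laws then hold because, by uniqueness
    of transposes, they may be checked after evaluation, where they follow from
    the naturality and coherence of the associator and the unitors. *)

Set Implicit Arguments.
Unset Strict Implicit.
Unset Printing Implicit Defensive.

(** * Category laws and functoriality of the tensor product *)

Lemma compA (I : Type) (X Y Z W : slice I) (h : hom Z W) (g : hom Y Z)
  (f : hom X Y) : comp h (comp g f) = comp (comp h g) f.
Proof. by apply: hom_ext. Qed.

Lemma comp1h (I : Type) (X Y : slice I) (f : hom X Y) : comp (idhom Y) f = f.
Proof. by apply: hom_ext. Qed.

Lemma comph1 (I : Type) (X Y : slice I) (f : hom X Y) : comp f (idhom X) = f.
Proof. by apply: hom_ext. Qed.

Lemma tensor_eq (X Y : grdset) (p q : tensor X Y) :
  (sval p).1 = (sval q).1 -> (sval p).2 = (sval q).2 -> p = q.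
Proof.
move=> E1 E2; apply: fprod_over_inj.
by move: E1 E2; case: (sval p) (sval q) => [? ?] [? ?] /= -> ->.
Qed.

Lemma tensor_hom_comp (X X' X'' Y Y' Y'' : grdset) (f' : hom X' X'')
  (f : hom X X') (g' : hom Y' Y'') (g : hom Y Y') :
  tensor_hom (comp f' f) (comp g' g)
  = comp (tensor_hom f' g') (tensor_hom f g).
Proof. by apply: hom_ext => p; apply: tensor_eq => //=; rewrite -map_comp. Qed.

Lemma tensor_hom1 (X Y : grdset) :
  tensor_hom (idhom X) (idhom Y) = idhom (tensor X Y).
Proof. by apply: hom_ext => p; apply: tensor_eq => //=; rewrite map_id. Qed.

(** * Naturality and coherence of the associator and the unitors *)

Lemma assoc_natural (X X' Y Y' Z Z' : grdset) (f : hom X X') (g : hom Y Y')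
  (h : hom Z Z') :
  comp assoc (tensor_hom f (tensor_hom g h))
  = comp (tensor_hom (tensor_hom f g) h) assoc.
Proof.
apply: hom_ext => p; apply: tensor_eq => /=; last first.
  by rewrite map_flatten -!map_comp.
by apply: tensor_eq => //=; rewrite -!map_comp.
Qed.

Lemma assoc_pentagon (X Y Z W : grdset) :
  comp (tensor_hom (@assoc X Y Z) (idhom W))
    (comp assoc (tensor_hom (idhom X) (@assoc Y Z W)))
  = comp assoc assoc.
Proof.
apply: hom_ext => p; apply: tensor_eq => /=; last first.
  (* The words in [W]: flattening block by block agrees with flattening at once, which is
     associativity of the free monoid multiplication. *)
  rewrite map_id -map_comp; elim: (sval p).2 => //= q w ->.
  by rewrite map_cat flatten_cat.
apply: (@tensor_eq (tensor X Y) Z) => /=.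
  by apply: (@tensor_eq X Y); rewrite /= -?map_comp.
by rewrite map_flatten -!map_comp.
Qed.

(** Letters are compared below as one-letter words, so that the length proof inside [the_letter]
    never has to be destructed. *)
Lemma lunit_funE (X : grdset) (p : tensor grdunit X) :
  [:: lunit_fun p] = (sval p).2.
Proof. exact: the_letterK. Qed.

Lemma lunit_natural (X Y : grdset) (f : hom X Y) :
  comp lunit (tensor_hom (idhom grdunit) f) = comp f lunit.
Proof.
apply: hom_ext => p /=.
suff: [:: lunit_fun (tensor_fun (idhom grdunit) f p)] = [:: f (lunit_fun p)].
  by case.
by rewrite lunit_funE /= -lunit_funE.
Qed.

(** Kelly's unit coherence, a consequence of pentagon and triangle in any monoidal category; here it
    is checked on elements. *)
Lemma assoc_lunit (X Y : grdset) :
  comp (tensor_hom (@lunit X) (idhom Y)) assoc = lunit.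
Proof.
apply: hom_ext => p /=; have E := lunit_funE p.
apply: tensor_eq => /=; last by rewrite map_id -E /= cats0.
suff: [:: lunit_fun (assoc_left p)] = [:: (sval (lunit_fun p)).1] by case.
by rewrite lunit_funE /= -E.
Qed.

(** The triangle axiom. *)
Lemma assoc_runit (X Y : grdset) :
  comp (tensor_hom (@runit X) (idhom Y)) assoc
  = tensor_hom (idhom X) (@lunit Y).
Proof.
apply: hom_ext => p; apply: tensor_eq => //=; rewrite map_id.
by elim: (sval p).2 => //= q w ->; rewrite -lunit_funE.
Qed.

(** * Invertibility of the associator *)

Section AssocInverse.
Variables Y Z : grdset.

Lemma chop_head (b : Y) (psi : seq Y) (w : seq Z) :
  sumn (map (over Y) (b :: psi)) = size w ->
  over Y b = size (take (over Y b) w).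
Proof. by move=> /= e; rewrite size_takel // -e leq_addr. Qed.

Lemma chop_tail (b : Y) (psi : seq Y) (w : seq Z) :
  sumn (map (over Y) (b :: psi)) = size w ->
  sumn (map (over Y) psi) = size (drop (over Y b) w).
Proof. by move=> /= e; rewrite size_drop -e addKn. Qed.

(** Each block has to carry its own length proof, so the length equation is passed along the
    recursion. *)
Fixpoint chop (psi : seq Y) (w : seq Z) :
    sumn (map (over Y) psi) = size w -> seq (tensor Y Z) :=
  match psi with
  | [::] => fun=> [::]
  | b :: psi' => fun e =>
      (exist _ (b, take (over Y b) w) (chop_head e) : tensor Y Z)
      :: chop (chop_tail e)
  end.

Lemma chop_letters (psi : seq Y) (w : seq Z)
  (e : sumn (map (over Y) psi) = size w) :
  [seq (sval q).1 | q <- chop e] = psi.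
Proof. by elim: psi w e => //= b psi IH w e; rewrite IH. Qed.

Lemma chop_flatten (psi : seq Y) (w : seq Z)
  (e : sumn (map (over Y) psi) = size w) :
  flatten [seq (sval q).2 | q <- chop e] = w.
Proof.
elim: psi w e => [|b psi IH] w e /=; first by case: w e.
by rewrite IH cat_take_drop.
Qed.

(** The letters in [Y] fix the lengths of the blocks, and a concatenation with known block lengths
    can be cut in only one way. *)
Lemma chop_unique (v v' : seq (tensor Y Z)) :
  [seq (sval q).1 | q <- v] = [seq (sval q).1 | q <- v'] ->
  flatten [seq (sval q).2 | q <- v] = flatten [seq (sval q).2 | q <- v'] ->
  v = v'.
Proof.
elim: v v' => [|q v IH] [|q' v'] //= [Eq Ev] E.
have sz : size (sval q).2 = size (sval q').2.
  by rewrite -(svalP q) -(svalP q') Eq.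
have Eq2 : (sval q).2 = (sval q').2.
  have := congr1 (take (size (sval q).2)) E.
  by rewrite take_size_cat // sz take_size_cat.
move: E; rewrite Eq2 => /(congr1 (drop (size (sval q').2))).
by rewrite !drop_size_cat // => /(IH _ Ev) ->; rewrite (tensor_eq Eq Eq2).
Qed.

Variable X : grdset.

Lemma assoc_inv_wd (p : tensor (tensor X Y) Z) :
  over X (sval (sval p).1).1 = size (chop (svalP p)).
Proof.
rewrite (svalP (sval p).1) -[in LHS](chop_letters (svalP p)).
exact: size_map.
Qed.

Definition assoc_inv_fun (p : tensor (tensor X Y) Z) :
  tensor X (tensor Y Z) :=
  exist _ ((sval (sval p).1).1, chop (svalP p)) (assoc_inv_wd p).

Lemma assoc_inv_funK : cancel assoc_inv_fun (@assoc_fun X Y Z).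
Proof.
move=> p; apply: tensor_eq => /=; last exact: chop_flatten.
by apply: tensor_eq => //=; exact: chop_letters.
Qed.

(** Inherited from [assoc_over], since [assoc_inv_fun] is a section of [assoc_fun]. *)
Lemma assoc_inv_over (p : tensor (tensor X Y) Z) :
  over (tensor X (tensor Y Z)) (assoc_inv_fun p)
  = over (tensor (tensor X Y) Z) p.
Proof. by rewrite -[in RHS](assoc_inv_funK p) assoc_over. Qed.

Definition assoc_inv : hom (tensor (tensor X Y) Z) (tensor X (tensor Y Z)) :=
  Hom assoc_inv_over.

Lemma assoc_invK : comp assoc assoc_inv = idhom (tensor (tensor X Y) Z).
Proof. by apply: hom_ext => p; exact: assoc_inv_funK. Qed.

Lemma assocK : comp assoc_inv assoc = idhom (tensor X (tensor Y Z)).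
Proof.
apply: hom_ext => p; apply: tensor_eq => //=.
by apply: chop_unique; rewrite ?chop_letters ?chop_flatten.
Qed.

(** A split epimorphism is epi. Equations can thus be checked on the right-nested product, where
    [chop] does not occur. *)
Lemma assoc_epi (A : grdset) (f g : hom (tensor (tensor X Y) Z) A) :
  comp f assoc = comp g assoc -> f = g.
Proof.
by move=> E; rewrite -[f]comph1 -[g]comph1 -assoc_invK !compA E.
Qed.

End AssocInverse.

Lemma tensor_assoc_epi (X Y Z W A : grdset)
  (f g : hom (tensor W (tensor (tensor X Y) Z)) A) :
  comp f (tensor_hom (idhom W) assoc) = comp g (tensor_hom (idhom W) assoc) ->
  f = g.
Proof.
move=> E; rewrite -[f]comph1 -[g]comph1 -tensor_hom1 -assoc_invK.
by rewrite -[idhom W]comph1 tensor_hom_comp !compA E.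
Qed.

Lemma ihom_curryK (C B A : grdset) (g : hom (tensor C B) A) :
  comp (ihom_ev B A) (tensor_hom (ihom_curry g) (idhom B)) = g.
Proof.
apply: hom_ext => p /=; rewrite /ihom_app /=; congr (g _).
by apply: tensor_eq; rewrite //= map_id.
Qed.

(** The uniqueness half of the adjunction. *)
Lemma ihom_ev_inj (C B A : grdset) (h h' : hom C (ihom B A)) :
  comp (ihom_ev B A) (tensor_hom h (idhom B))
  = comp (ihom_ev B A) (tensor_hom h' (idhom B)) -> h = h'.
Proof.
move=> E; have [k [_ k_uniq]] :=
  ihom_adjoint (comp (ihom_ev B A) (tensor_hom h (idhom B))).
by rewrite -(k_uniq h) // -(k_uniq h').
Qed.

(** * The monoid structure on [[X,X]] *)

Section Taut.
Variable X : grdset.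
Let T := taut X.
Let ev : hom (tensor T X) X := ihom_ev X X.

Definition taut_mul : hom (tensor T T) T :=
  ihom_curry (comp ev (comp (tensor_hom (idhom T) ev) (assoc_inv T X T))).

Definition taut_unit : hom grdunit T := ihom_curry lunit.

(** With [taut_unit_ev], this says that [ev] is an action of [T] on [X]. The monoid laws use
    [taut_mul] only through this equation. *)
Lemma taut_mul_ev :
  comp (comp ev (tensor_hom taut_mul (idhom X))) assoc
  = comp ev (tensor_hom (idhom T) ev).
Proof. by rewrite ihom_curryK -!compA assocK comph1. Qed.

Lemma taut_unit_ev : comp ev (tensor_hom taut_unit (idhom X)) = lunit.
Proof. exact: ihom_curryK. Qed.

Lemma ev_comp (C D : grdset) (h : hom D T) (k : hom C D) :
  comp ev (tensor_hom (comp h k) (idhom X))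
  = comp (comp ev (tensor_hom h (idhom X))) (tensor_hom k (idhom X)).
Proof. by rewrite -[in LHS](comph1 (idhom X)) tensor_hom_comp compA. Qed.

(** A product acts by its right factor first, then its left one: naturality of [assoc] moves [f] and
    [g] past it, and [taut_mul_ev] applies. *)
Lemma ev_mul_tensor (A B : grdset) (f : hom A T) (g : hom B T) :
  comp (comp ev (tensor_hom (comp taut_mul (tensor_hom f g)) (idhom X))) assoc
  = comp ev (tensor_hom f (comp ev (tensor_hom g (idhom X)))).
Proof.
rewrite ev_comp -compA -assoc_natural compA taut_mul_ev -compA.
by rewrite -tensor_hom_comp comp1h.
Qed.

Lemma taut_mul1l : comp taut_mul (tensor_hom taut_unit (idhom T)) = lunit.
Proof.
apply: ihom_ev_inj; apply: assoc_epi.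
rewrite ev_mul_tensor tensor_hom1 comph1 -[ihom_ev X X]/ev.
(* On the right side, naturality slides [lunit] past [ev], and [lunit] is then rewritten as the
   action of [taut_unit]. *)
rewrite -compA assoc_lunit -lunit_natural -taut_unit_ev -compA.
by rewrite -tensor_hom_comp comp1h comph1.
Qed.

Lemma taut_mul1r : comp taut_mul (tensor_hom (idhom T) taut_unit) = runit.
Proof.
apply: ihom_ev_inj; apply: assoc_epi.
by rewrite ev_mul_tensor taut_unit_ev -compA assoc_runit.
Qed.

Lemma taut_mulA :
  comp (comp taut_mul (tensor_hom taut_mul (idhom T))) assoc
  = comp taut_mul (tensor_hom (idhom T) taut_mul).
Proof.
apply: ihom_ev_inj; apply: assoc_epi; apply: tensor_assoc_epi.
(* Both sides reduce to the threefold evaluation on [T □ (T □ (T □ X))]; this is the right side. *)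
have -> : comp (comp (comp ev (tensor_hom (comp taut_mul
    (tensor_hom (idhom T) taut_mul)) (idhom X))) assoc)
    (tensor_hom (idhom T) assoc)
    = comp ev (tensor_hom (idhom T) (comp ev (tensor_hom (idhom T) ev))).
  by rewrite ev_mul_tensor -compA -tensor_hom_comp comph1 taut_mul_ev.
(* On the left side, the pentagon trades three reassociations for two, and [ev_mul_tensor] absorbs
   one of them. *)
rewrite ev_comp -!compA assoc_pentagon [LHS]compA [LHS]compA.
rewrite ev_mul_tensor tensor_hom1 comph1.
(* Interchange: the inner evaluation goes first, so that [taut_mul] meets the remaining [assoc] as
   in [taut_mul_ev]. *)
have -> : tensor_hom taut_mul ev
    = comp (tensor_hom taut_mul (idhom X)) (tensor_hom (idhom (tensor T T)) ev).
  by rewrite -tensor_hom_comp comp1h comph1.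
rewrite -tensor_hom1 -!compA -assoc_natural !compA taut_mul_ev -compA.
by rewrite -tensor_hom_comp comph1.
Qed.

End Taut.

Theorem theorem4p1 (X : grdset) : inhabited (operad_structure (taut X)).
Proof.
exact: inhabits
  (OperadStructure (taut_mulA X) (taut_mul1l X) (taut_mul1r X)).
Qed.
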